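(* For all real $V,E,F$ such that $0<V<\min(E,F)$, $$\sup\Big\{\overline{x}-x^{\mathsf g}\colon n\in\mathbb{N},\ y\in[0,\infty)^n,\ x=y^2,\ \overline{(y-\overline y)^2}\le V,\ \overline{(y-y_{\min})^2}\le E\Big\}=\max(2V,E),$$ $$\inf\Big\{\overline{x}-x^{\mathsf g}\colon n\in\mathbb{N},\ y\in[0,\infty)^n,\ x=y^2,\ \overline{(y-\overline y)^2}\ge V,\ \overline{(y_{\max}-y)^2}\le F\Big\}=\min\Big(2V,\frac{FV}{F-V}\Big).$$
   Context: For $n\in\mathbb{N}$ (with $n\ge1$) and $z=(z_1,\dots,z_n)\in\mathbb{R}^n$: $\overline z:=\frac1n(z_1+\dots+z_n)$ is the arithmetic mean, $z^{\mathsf g}:=\sqrt[n]{|z_1\cdots z_n|}$ is the geometric mean, $z_{\max}:=\max(z_1,\dots,z_n)$, $z_{\min}:=\min(z_1,\dots,z_n)$. A function $f\colon\mathbb{R}\to\mathbb{R}$ is applied to a vector coordinatewise: $f(z):=(f(z_1),\dots,f(z_n))$. Thus $y^2=(y_1^2,\dots,y_n^2)$, $\overline{(y-\overline y)^2}=\frac1n\sum_{i=1}^n(y_i-\overline y)^2$, $\overline{(y-y_{\min})^2}=\frac1n\sum_{i=1}^n(y_i-y_{\min})^2$, and $\overline{(y_{\max}-y)^2}=\frac1n\sum_{i=1}^n(y_{\max}-y_i)^2$. The supremum and the infimum are taken over all $n$ as well as all $y$. *)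

(* Defs.v *)
From mathcomp Require Import all_boot all_order all_algebra.
From mathcomp Require Import all_classical all_reals all_analysis.
Set Implicit Arguments.
Unset Strict Implicit.
Unset Printing Implicit Defensive.
Import Order.TTheory GRing.Theory Num.Theory.
Local Open Scope ring_scope.

(* A vector of length at least 1 is a row vector of type 'rV[R]_n.+1, where
   n ranges over all of nat; its length is n.+1. *)

Definition amean (R : realType) (n : nat) (z : 'rV[R]_n.+1) : R :=
  n.+1%:R^-1 * \sum_i z ord0 i.

(* The root of order n.+1 is rendered as the power of exponent 1 / n.+1;
   since that exponent is nonzero, 0 `^ n.+1%:R^-1 = 0. *)
Definition gmean (R : realType) (n : nat) (z : 'rV[R]_n.+1) : R :=
  `|\prod_i z ord0 i| `^ n.+1%:R^-1.

(* The default element of the big operator is a coordinate of z, so these are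
   the true extrema whatever the signs of the coordinates. *)
Definition vmax (R : realType) (n : nat) (z : 'rV[R]_n.+1) : R :=
  \big[Num.max/z ord0 ord0]_i z ord0 i.

Definition vmin (R : realType) (n : nat) (z : 'rV[R]_n.+1) : R :=
  \big[Num.min/z ord0 ord0]_i z ord0 i.

(* Main.v *)
(* Write y_i = c (1 + w_i) with c = min y (so w >= 0) or c = max y (so
   -1 <= w <= 0).  Since ln (1 + z) = z g(z) with g convex, Jensen's inequality
   for the weights w_i / sum w compares the mean of ln (1 + w_i) with
   (m / b) ln (1 + b), where m is the mean of w and b = mean (w^2) / m: among
   the vectors with given first two moments of w, the extremal ones take only
   the values c and c (1 + b).  Hence the geometric mean of y^2 is compared
   with c^2 (1 + b)^r, r = 2 m / b, and the bounds follow from the second-order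
   Taylor bound of (1 + b)^r when r <= 1 and from Bernoulli's inequality when
   r >= 1.
   The value 2V is approached by two-valued vectors of variance V translated
   to infinity, the other value by two-valued vectors with minimum 0. *)
Require Import Defs.
From mathcomp Require Import all_boot all_order all_algebra.
From mathcomp Require Import all_classical all_reals all_analysis.
From mathcomp Require Import ring lra.
Set Implicit Arguments.
Unset Strict Implicit.
Unset Printing Implicit Defensive.
Import Order.TTheory GRing.Theory Num.Theory.
Local Open Scope classical_set_scope.
Local Open Scope ring_scope.

(** * Calculus estimates for the logarithm and real powers *)

Lemma is_derive_ge0_le (R : realType) (f df : R -> R) (a b : R) : a <= b ->
  (forall x, a <= x <= b -> is_derive x 1 f (df x)) ->
  (forall x, a <= x <= b -> 0 <= df x) -> f a <= f b.
Proof.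
move=> ab fdf df_ge0.
have [||c] := @MVT_segment R f df a b ab.
- by move=> x; rewrite in_itv /= => /andP[ax xb]; apply: fdf; rewrite !ltW.
- apply: derivable_within_continuous => x; rewrite in_itv /= => xab.
  by have [] := fdf _ xab.
rewrite in_itv /= => cab fba; rewrite -subr_ge0 fba mulr_ge0 ?subr_ge0//.
exact: df_ge0.
Qed.

(* At s = 1 this function is ln (1 + z) - q for the q of the next lemma, up to
   its value at s = 0; the derivative has the sign of z. *)
Lemma ln_tangent_deriv (R : realType) (b z s : R) : b != 0 ->
  0 < 1 + s * z -> 0 < 1 + s * b ->
  is_derive s 1 (fun s : R => ln (1 + s * z) - z / b * ln (1 + s * b) +
      z * (z - b) / b ^+ 2 * (ln (1 + s * b) + (1 + s * b)^-1))
    (z * (s ^+ 2 * (z - b) ^+ 2 / ((1 + s * z) * (1 + s * b) ^+ 2))).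
Proof.
move=> b0 hz hb.
have D1 (c : R) : 0 < 1 + s * c ->
    is_derive s 1 (fun s : R => ln (1 + s * c)) (c / (1 + s * c)).
  move=> hc.
  have := is_derive1_ln hc => ?.
  apply: is_derive_eq.
  by rewrite /GRing.scale /=; ring.
have Dz := D1 z hz; have Db := D1 b hb.
have nb : 1 + s * b != 0 by rewrite gt_eqF.
have DV : is_derive s 1 (fun s : R => (1 + s * b)^-1) (- (1 + s * b) ^- 2 * b).
  have D0 : is_derive s 1 (fun s : R => 1 + s * b) b.
    by apply: is_derive_eq; rewrite /GRing.scale /=; ring.
  have := @is_deriveV R (fun s => 1 + s * b) s b 1 nb D0.
  by rewrite /GRing.scale /=.
apply: is_derive_eq.
rewrite /GRing.scale /=.
by field; rewrite b0 nb gt_eqF.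
Qed.

(* q is z times the tangent line at b of the convex function
   z |-> ln (1 + z) / z, whence the dependence on the sign of z. *)
Lemma ln1Dx_tangent (R : realType) (b z : R) : b != 0 -> -1 < b -> -1 < z ->
  let q := z / b * ln (1 + b) - z * (z - b) / b ^+ 2 * (ln (1 + b) - b / (1 + b)) in
  (0 <= z -> q <= ln (1 + z)) /\ (z <= 0 -> ln (1 + z) <= q).
Proof.
move=> b0 hb hz q.
pose G s := z * (s ^+ 2 * (z - b) ^+ 2 / ((1 + s * z) * (1 + s * b) ^+ 2)).
pose H (s : R) := ln (1 + s * z) - z / b * ln (1 + s * b) +
      z * (z - b) / b ^+ 2 * (ln (1 + s * b) + (1 + s * b)^-1).
have pos (c s : R) : -1 < c -> 0 <= s <= 1 -> 0 < 1 + s * c.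
  move=> c1 /andP[s0]; rewrite le_eqVlt => /orP[/eqP -> | s1]; first lra.
  by have : 0 <= s * (1 + c) by [rewrite mulr_ge0//; lra]; lra.
have HD (s : R) : 0 <= s <= 1 -> is_derive s 1 H (G s).
  by move=> s01; apply: ln_tangent_deriv => //; exact: pos.
have H01 : H 1 - H 0 = ln (1 + z) - q.
  rewrite /H /q !mul0r !mul1r !addr0 ln1 invr1.
  by field; rewrite b0 gt_eqF//; lra.
have GE (s : R) : 0 <= s <= 1 ->
    0 <= s ^+ 2 * (z - b) ^+ 2 / ((1 + s * z) * (1 + s * b) ^+ 2).
  by move=> s01; apply: divr_ge0; apply: mulr_ge0; rewrite ?sqr_ge0 ?ltW ?pos.
split=> zs.
  suff : H 0 <= H 1 by move: H01; lra.
  apply: (@is_derive_ge0_le _ _ G _ _ ler01 HD) => s s01.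
  by rewrite mulr_ge0 ?GE.
suff : - H 0 <= - H 1 by move: H01; lra.
apply: (@is_derive_ge0_le _ (fun s => - H s) (fun s => - G s) _ _ ler01) => s s01.
  by have := HD s s01 => ?; apply: is_deriveN.
by rewrite oppr_ge0 mulr_le0_ge0 ?GE.
Qed.

(** The power minus its Taylor polynomial is nondecreasing on (-1, oo): its derivative [G] is
    nonnegative by Bernoulli's inequality for the exponent r - 1 <= 0. *)
Lemma powR1D_taylor2 (R : realType) (t r : R) : -1 < t -> 0 <= r <= 1 ->
  let q := 1 + r * t + r * (r - 1) / 2 * t ^+ 2 in
  (0 <= t -> q <= (1 + t) `^ r) /\ (t <= 0 -> (1 + t) `^ r <= q).
Proof.
move=> ht /andP[r0 r1] q.
pose H (s : R) := (1 + s) `^ r - r * s - r * (r - 1) / 2 * s ^+ 2.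
pose G s := r * ((1 + s) `^ (r - 1) - 1 - (r - 1) * s).
have HD (s : R) : -1 < s -> is_derive s 1 H (G s).
  move=> hs; have s1 : 0 < 1 + s by lra.
  have D1 := is_derive1_powR r s1.
  have D : is_derive s 1 (fun s : R => (1 + s) `^ r) (r * (1 + s) `^ (r - 1)).
    rewrite -[r * _]mulr1.
    have D0 : is_derive s 1 (fun s : R => 1 + s) 1.
      by apply: is_derive_eq; ring.
    exact: (@is_derive1_comp R (fun x => x `^ r) (fun s => 1 + s) s _ _ D1 D0).
  rewrite /H; apply: is_derive_eq.
  by rewrite /G /GRing.scale /=; field.
have G0 (s : R) : -1 < s -> 0 <= G s.
  move=> hs; rewrite mulr_ge0// -addrA -opprD subr_ge0.
  (* (1 + s)^(r - 1) = exp ((r - 1) ln (1 + s)) >= 1 + (r - 1) ln (1 + s), and ln (1 + s) <= s gets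
     multiplied by r - 1 <= 0. *)
  rewrite /powR gt_eqF; last lra.
  apply: le_trans (expR_ge1Dx _).
  by rewrite lerD2l ler_wnM2l ?le_ln1Dx//; lra.
have H0 : H 0 = 1 by rewrite /H addr0 powR1 expr2 !mulr0 !subr0.
split=> ts.
  suff : H 0 <= H t by rewrite H0 /H /q => ?; lra.
  by apply: (@is_derive_ge0_le _ H G _ _ ts) => s hs; [apply: HD|apply: G0]; lra.
suff : H t <= H 0 by rewrite H0 /H /q => ?; lra.
by apply: (@is_derive_ge0_le _ H G _ _ ts) => s hs; [apply: HD|apply: G0]; lra.
Qed.

(** On [-1/2, oo) the derivative s^2 / (1 + s) of the remainder [k] lies between 0 and 3 s^2, so k
    and s^3 - k are both nondecreasing; they vanish at 0. *)
Lemma ln1D_taylor2 (R : realType) (u : R) : `|u| <= 1 / 2 ->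
  `|ln (1 + u) - u + u ^+ 2 / 2| <= `|u| ^+ 3.
Proof.
rewrite ler_norml => /andP[ul uu].
pose k (s : R) := ln (1 + s) - s + s ^+ 2 / 2.
have k0 : k 0 = 0 by rewrite /k addr0 ln1 expr2 !mul0r subrr addr0.
have kD (s : R) : - (1 / 2) <= s -> is_derive s 1 k (s ^+ 2 / (1 + s)).
  move=> hs; have s1 : 0 < 1 + s by lra.
  have D := is_derive1_ln s1; rewrite /k; apply: is_derive_eq.
  by rewrite /GRing.scale /=; field; rewrite gt_eqF.
have kD' (s : R) : - (1 / 2) <= s ->
    is_derive s 1 (fun s => s ^+ 3 - k s) (3 * s ^+ 2 - s ^+ 2 / (1 + s)).
  move=> /kD D; apply: is_derive_eq.
  by rewrite /GRing.scale /=; ring.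
have dk (s : R) : - (1 / 2) <= s -> 0 <= s ^+ 2 / (1 + s) <= 3 * s ^+ 2.
  move=> hs; have s1 : 0 < 1 + s by lra.
  rewrite divr_ge0 ?sqr_ge0 ?(ltW s1)//= ler_pdivrMr//.
  have := sqr_ge0 s; nra.
have mono (s t : R) : - (1 / 2) <= s -> s <= t ->
    k s <= k t /\ s ^+ 3 - k s <= t ^+ 3 - k t.
  move=> hs st; split.
    apply: (@is_derive_ge0_le _ k (fun x => x ^+ 2 / (1 + x)) _ _ st) => x hx.
      by apply: kD; lra.
    by have /andP[] : 0 <= x ^+ 2 / (1 + x) <= 3 * x ^+ 2 by apply: dk; lra.
  apply: (@is_derive_ge0_le _ (fun x => x ^+ 3 - k x)
    (fun x => 3 * x ^+ 2 - x ^+ 2 / (1 + x)) _ _ st) => x hx.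
    by apply: kD'; lra.
  rewrite subr_ge0.
  by have /andP[] : 0 <= x ^+ 2 / (1 + x) <= 3 * x ^+ 2 by apply: dk; lra.
rewrite -/(k u).
have [u0|u0] := lerP 0 u.
  have [|] := mono 0 u _ u0; first lra.
  rewrite k0 expr0n subr0 /= => k1 k2.
  by rewrite !ger0_norm//; lra.
have [|] := mono u 0 _ (ltW u0); first lra.
rewrite k0 expr0n subr0 /= => k1 k2.
rewrite (ler0_norm k1) (ltr0_norm u0).
have -> : (- u) ^+ 3 = - u ^+ 3 by ring.
lra.
Qed.

(** Concavity of ln: the tangent at 1 + s t is evaluated at 1 + t and at 1 with weights s and 1 - s,
    and the linear terms cancel. *)
Lemma ln1D_bernoulli (R : realType) (s t : R) : 0 <= s <= 1 -> -1 < t ->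
  s * ln (1 + t) <= ln (1 + s * t).
Proof.
move=> /andP[s0 s1] t1.
have A0 : 0 < 1 + s * t.
  move: s1; rewrite le_eqVlt => /orP[/eqP -> | s1]; first lra.
  by have : 0 <= s * (1 + t) by [rewrite mulr_ge0//; lra]; lra.
have t0 : 0 < 1 + t by lra.
have L (x : R) : 0 < x -> ln x - ln (1 + s * t) <= x / (1 + s * t) - 1.
  move=> x0; rewrite -ln_div ?posrE//.
  rewrite -[X in ln X](subrKC 1); apply: le_ln1Dx.
  by have := divr_gt0 x0 A0; lra.
have h1 := ler_wpM2l s0 (L _ t0).
have s2 : 0 <= 1 - s by lra.
have h2 := ler_wpM2l s2 (L _ ltr01).
have E : s * ((1 + t) / (1 + s * t) - 1) + (1 - s) * (1 / (1 + s * t) - 1) = 0.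
  by field; rewrite gt_eqF.
move: h1 h2 E; rewrite ln1; lra.
Qed.

(** * Means of finite families, and the geometric mean of squares *)

(** [amean] on plain functions, so that w, its powers and ln (1 + w) need not be packed as row
    vectors. *)
Definition mean (R : realType) (n : nat) (u : 'I_n.+1 -> R) : R :=
  n.+1%:R^-1 * \sum_i u i.

Lemma amean_map (R : realType) (n : nat) (f : R -> R) (y : 'rV[R]_n.+1) :
  amean (map_mx f y) = mean (fun i => f (y ord0 i)).
Proof. by congr (_ * _); apply: eq_bigr => i _; rewrite mxE. Qed.

(** This shape covers the quadratic polynomials in w met below; shorter combinations are padded with
    zero coefficients, whence the terms [0 + _] and [0 * _]. *)
Lemma mean_lin (R : realType) (n : nat) (a b c : R) (u v : 'I_n.+1 -> R) :
  mean (fun i => a + b * u i + c * v i) = a + b * mean u + c * mean v.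
Proof.
rewrite /mean !big_split /= sumr_const card_ord -!mulr_sumr -[a *+ _]mulr_natr.
have : n.+1%:R != 0 :> R by rewrite pnatr_eq0.
by move: n.+1%:R => N N0; field.
Qed.

Lemma eq_mean (R : realType) (n : nat) (u v : 'I_n.+1 -> R) :
  u =1 v -> mean u = mean v.
Proof. by move=> uv; congr (_ * _); apply: eq_bigr. Qed.

Lemma le_mean (R : realType) (n : nat) (u v : 'I_n.+1 -> R) :
  (forall i, u i <= v i) -> mean u <= mean v.
Proof. by move=> uv; rewrite ler_wpM2l ?invr_ge0 ?ler0n ?ler_sum. Qed.

Lemma lt_mean (R : realType) (n : nat) (u v : 'I_n.+1 -> R) j :
  (forall i, u i <= v i) -> u j < v j -> mean u < mean v.
Proof.
move=> uv uvj; rewrite ltr_pM2l ?invr_gt0 ?ltr0n//.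
rewrite (bigD1 j)//= [ltRHS](bigD1 j)//=.
by rewrite ltr_leD ?ler_sum.
Qed.

Lemma mean_ge0 (R : realType) (n : nat) (u : 'I_n.+1 -> R) :
  (forall i, 0 <= u i) -> 0 <= mean u.
Proof. by move=> u0; rewrite mulr_ge0 ?invr_ge0 ?ler0n ?sumr_ge0. Qed.

Lemma variance_mean (R : realType) (n : nat) (u : 'I_n.+1 -> R) :
  mean (fun i => (u i - mean u) ^+ 2) = mean (fun i => u i ^+ 2) - mean u ^+ 2.
Proof.
rewrite (@eq_mean _ _ _ (fun i => mean u ^+ 2 + (- 2 * mean u) * u i + 1 * u i ^+ 2)).
  by rewrite mean_lin; ring.
by move=> i /=; ring.
Qed.

Lemma gmean_sqr (R : realType) (n : nat) (y : 'rV[R]_n.+1) :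
  (forall i, 0 < y ord0 i) ->
  gmean (map_mx (fun t => t ^+ 2) y) = expR (2 * mean (fun i => ln (y ord0 i))).
Proof.
move=> y0; rewrite /gmean.
under eq_bigr => i _.
  rewrite mxE -[y ord0 i]lnK ?posrE// -expRM_natl.
  over.
rewrite -expR_sum ger0_norm ?expR_ge0// -expRM; congr expR.
by rewrite -mulr_sumr /mean; ring.
Qed.

Lemma gmean_sqr0 (R : realType) (n : nat) (y : 'rV[R]_n.+1) i :
  y ord0 i = 0 -> gmean (map_mx (fun t => t ^+ 2) y) = 0.
Proof.
move=> yi; rewrite /gmean (bigD1 i)//= mxE yi expr0n mul0r normr0 powR0//.
Qed.

Lemma sqr_mean_le (R : realType) (n : nat) (u : 'I_n.+1 -> R) :
  mean u ^+ 2 <= mean (fun i => u i ^+ 2).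
Proof.
by rewrite -subr_ge0 -variance_mean; apply: mean_ge0 => i; exact: sqr_ge0.
Qed.

(** * Bounds on the mean of ln (1 + w) by the first two moments of w *)

(** The tangent bound at b is the quadratic (L / b + b K) z - K z^2. In its mean the two K terms
    cancel, because the second moment is b times the first. *)
Lemma mean_ln1D_ge (R : realType) (n : nat) (w : 'I_n.+1 -> R) (b : R) :
  b != 0 -> -1 < b -> (forall i, 0 <= w i) ->
  mean (fun i => w i ^+ 2) = b * mean w ->
  mean w / b * ln (1 + b) <= mean (fun i => ln (1 + w i)).
Proof.
move=> b0 b1 w0 wb; set L := ln (1 + b).
pose K := (L - b / (1 + b)) / b ^+ 2.
apply: le_trans (_ : mean (fun i => 0 + (L / b + b * K) * w i + (- K) * w i ^+ 2) <= _).
  by rewrite mean_lin wb; rewrite le_eqVlt; apply/predU1P; left; field.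
apply: le_mean => i.
have w1 : -1 < w i by apply: lt_le_trans (w0 i); lra.
apply: le_trans ((ln1Dx_tangent b0 b1 w1).1 (w0 i)).
by rewrite le_eqVlt; apply/predU1P; left; rewrite /K -/L; field; rewrite b0 gt_eqF//; lra.
Qed.

Lemma mean_ln1D_le (R : realType) (n : nat) (w : 'I_n.+1 -> R) (b : R) :
  b != 0 -> -1 < b -> (forall i, -1 < w i <= 0) ->
  mean (fun i => w i ^+ 2) = b * mean w ->
  mean (fun i => ln (1 + w i)) <= mean w / b * ln (1 + b).
Proof.
move=> b0 b1 w0 wb; set L := ln (1 + b).
pose K := (L - b / (1 + b)) / b ^+ 2.
apply: le_trans (_ : _ <= mean (fun i =>
  0 + (L / b + b * K) * w i + (- K) * w i ^+ 2)) _; last first.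
  by rewrite mean_lin wb; rewrite le_eqVlt; apply/predU1P; left; field.
apply: le_mean => i; have /andP[w1 wi0] := w0 i.
apply: le_trans ((ln1Dx_tangent b0 b1 w1).2 wi0) _.
by rewrite le_eqVlt; apply/predU1P; left; rewrite /K -/L; field; rewrite b0 gt_eqF//; lra.
Qed.

(** The upper bound on the gap between the means, normalized to minimum 1: the sum 1 + 2 m + s is
    the mean of (1 + w)^2. *)
Lemma expR_mean_ln_ge (R : realType) (n : nat) (w : 'I_n.+1 -> R) :
  (forall i, 0 <= w i) ->
  1 + 2 * mean w + mean (fun i => w i ^+ 2) -
    Num.max (2 * (mean (fun i => w i ^+ 2) - mean w ^+ 2))
            (mean (fun i => w i ^+ 2)) <=
  expR (2 * mean (fun i => ln (1 + w i))).
Proof.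
move=> w0; set m := mean w; set s := mean (fun i => w i ^+ 2).
have m0 : 0 <= m by apply: mean_ge0.
have ms : m ^+ 2 <= s by exact: sqr_mean_le.
(* b = s / m requires m > 0. For m = 0 the left side is at most 1 by the second entry of the max,
   and every logarithm is nonnegative. *)
move: m0; rewrite le_eqVlt => /orP[/eqP m0|m0].
  apply: (@le_trans _ _ 1).
    by rewrite -m0 -addrA mulr0 addr0 gerDl subr_le0 le_max lexx orbT.
  rewrite -[leLHS]expR0 ler_expR mulr_ge0//; apply: mean_ge0 => i.
  by apply: ln_ge0; rewrite lerDl.
have s0 : 0 < s by apply: lt_le_trans ms; rewrite exprn_gt0.
pose b := s / m; pose r := 2 * m / b.
have b0 : 0 < b by rewrite divr_gt0.
have sE : s = b * m by rewrite /b divfK ?gt_eqF.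
have r0 : 0 <= r by rewrite divr_ge0 ?ltW// mulr_gt0.
have rb : r * b = 2 * m by rewrite /r divfK ?gt_eqF.
have b1 : -1 < b by lra.
apply: (@le_trans _ _ (expR (r * ln (1 + b)))); last first.
  have -> : r * ln (1 + b) = 2 * (m / b * ln (1 + b)) by rewrite /r; ring.
  rewrite ler_expR ler_pM2l//; apply: mean_ln1D_ge => //.
  by rewrite gt_eqF.
have [r1|r1] := lerP r 1.
  have r01 : 0 <= r <= 1 by rewrite r0.
  have [T _] := powR1D_taylor2 b1 r01.
  have := T (ltW b0); rewrite /powR gt_eqF; last by lra.
  apply: le_trans.
  apply: (@le_trans _ _ (1 + 2 * m + s - 2 * (s - m ^+ 2))).
    by rewrite lerD2l lerN2 le_max lexx.
  (* Since r b = 2 m and b m = s, the quadratic Taylor term is 2 m^2 - s. *)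
  have -> : r * (r - 1) / 2 * b ^+ 2 = (r * b) ^+ 2 / 2 - (r * b) * b / 2 by field.
  by rewrite rb sE; rewrite le_eqVlt; apply/predU1P; left; field.
apply: (@le_trans _ _ (1 + r * b)).
  by rewrite rb -addrA gerDl subr_le0 le_max lexx orbT.
have rb0 : 0 < 1 + r * b by rewrite rb; lra.
rewrite -[leLHS]lnK ?posrE// ler_expR.
(* Bernoulli is applied with exponent 1 / r at the point r b. *)
have rinv : 0 <= r^-1 <= 1 by rewrite invr_ge0 r0 invf_le1 ?ltW//; lra.
have rb1 : -1 < r * b by lra.
have r_gt0 : 0 < r by lra.
have := ln1D_bernoulli rinv rb1.
by rewrite mulKf ?gt_eqF// ler_pdivrMl.
Qed.

(** The lower bound on the gap, normalized to maximum 1. With F = s and V = s - m^2, the second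
    entry of the min is F V / (F - V). *)
Lemma expR_mean_ln_le (R : realType) (n : nat) (w : 'I_n.+1 -> R) :
  (forall i, -1 < w i <= 0) ->
  mean w < 0 ->
  expR (2 * mean (fun i => ln (1 + w i))) <=
  1 + 2 * mean w + mean (fun i => w i ^+ 2) -
    Num.min (2 * (mean (fun i => w i ^+ 2) - mean w ^+ 2))
            (mean (fun i => w i ^+ 2) *
               (mean (fun i => w i ^+ 2) - mean w ^+ 2) / mean w ^+ 2).
Proof.
move=> w0; set m := mean w; set s := mean (fun i => w i ^+ 2) => m0.
have ms : m ^+ 2 <= s by exact: sqr_mean_le.
have s0 : 0 < s by apply: lt_le_trans ms; rewrite exprn_even_gt0//= lt_eqF.
pose b := s / m; pose r := 2 * m / b.
have b0 : b < 0 by rewrite /b pmulr_rlt0 ?invr_lt0.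
have sE : s = b * m by rewrite /b divfK ?lt_eqF.
have rb : r * b = 2 * m by rewrite /r divfK ?lt_eqF.
have [j wj] : exists j, w j < 0.
  apply/existsP; rewrite -[X in is_true X]negbK negb_exists; apply/negP => /forallP w0'.
  move: m0; rewrite ltNge mean_ge0// => i; rewrite leNgt; exact: w0'.
(* (1 + b) m = m + s is the mean of w (1 + w), whose terms are nonpositive, and negative at j. *)
have b1 : -1 < b.
  suff : (1 + b) * m < 0 by rewrite nmulr_llt0//; lra.
  have -> : (1 + b) * m = mean (fun i => 0 + 1 * w i + 1 * w i ^+ 2).
    by rewrite mean_lin -/m -/s sE; ring.
  have z : mean (fun i => 0 + 0 * w i + 0 * w i) = 0 by rewrite mean_lin; ring.
  rewrite -[ltRHS]z.
  apply: (@lt_mean _ _ _ _ j) => [i|] /=.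
    have /andP[w1 wi0] := w0 i.
    by have : 0 <= - w i * (1 + w i) by [rewrite mulr_ge0//; lra]; lra.
  have /andP[w1 _] := w0 j.
  by have : 0 < - w j * (1 + w j) by [rewrite mulr_gt0//; lra]; lra.
have mb : b <= m by rewrite /b ler_ndivrMr// -expr2.
have r0 : 0 < r by rewrite -(nmulr_llt0 _ b0) rb; lra.
have r2 : r <= 2 by rewrite -(ler_nM2r b0) rb; lra.
apply: (@le_trans _ _ (expR (r * ln (1 + b)))).
  have -> : r * ln (1 + b) = 2 * (m / b * ln (1 + b)) by rewrite /r; ring.
  rewrite ler_expR ler_pM2l//; apply: mean_ln1D_le => //.
  by rewrite lt_eqF.
have [r1|r1] := lerP r 1.
  have r01 : 0 <= r <= 1 by rewrite ltW.
  have [_ T] := powR1D_taylor2 b1 r01.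
  have := T (ltW b0); rewrite /powR gt_eqF; last by lra.
  move=> /le_trans; apply.
  apply: (@le_trans _ _ (1 + 2 * m + s - 2 * (s - m ^+ 2))).
    have -> : r * (r - 1) / 2 * b ^+ 2 = (r * b) ^+ 2 / 2 - (r * b) * b / 2 by field.
    by rewrite rb sE; rewrite le_eqVlt; apply/predU1P; left; field.
  by rewrite lerD2l lerN2 ge_min lexx.
(* For 1 < r <= 2, factor (1 + b)^r = (1 + b) (1 + b)^(r - 1) and apply Bernoulli to the exponent r
   - 1 in [0, 1]. *)
have rb0 : 0 < 1 + (r - 1) * b by nra.
apply: (@le_trans _ _ ((1 + b) * (1 + (r - 1) * b))).
  rewrite -[X in _ <= X * _]lnK ?posrE; last by lra.
  rewrite -[X in _ <= _ * X]lnK ?posrE// -expRD ler_expR.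
  have r01 : 0 <= r - 1 <= 1 by apply/andP; split; lra.
  by have := ln1D_bernoulli r01 b1; lra.
apply: (@le_trans _ _ (1 + 2 * m + s - s * (s - m ^+ 2) / m ^+ 2)).
  have -> : (r - 1) * b = 2 * m - b by rewrite -rb; ring.
  by rewrite sE le_eqVlt; apply/predU1P; left; field; rewrite lt_eqF.
by rewrite lerD2l lerN2 ge_min lexx orbT.
Qed.

(** * Extrema of a vector, and the rescaling y = c (1 + w) *)

Lemma vmin_le (R : realType) (n : nat) (y : 'rV[R]_n.+1) i : vmin y <= y ord0 i.
Proof. exact: bigmin_le. Qed.

Lemma vmin_mem (R : realType) (n : nat) (y : 'rV[R]_n.+1) :
  exists i, vmin y = y ord0 i.
Proof.
rewrite /vmin; elim/big_ind: _ => [|a b [i ->] [j ->]|i _]; first by exists ord0.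
  by case: (leP (y ord0 i) (y ord0 j)) => _; [exists i | exists j].
by exists i.
Qed.

Lemma le_vmax (R : realType) (n : nat) (y : 'rV[R]_n.+1) i : y ord0 i <= vmax y.
Proof. exact: le_bigmax. Qed.

Lemma vmax_mem (R : realType) (n : nat) (y : 'rV[R]_n.+1) :
  exists i, vmax y = y ord0 i.
Proof.
rewrite /vmax; elim/big_ind: _ => [|a b [i ->] [j ->]|i _]; first by exists ord0.
  by case: (leP (y ord0 i) (y ord0 j)) => _; [exists j | exists i].
by exists i.
Qed.

Lemma amean_affine (R : realType) (n : nat) (y : 'rV[R]_n.+1) (c : R)
    (w : 'I_n.+1 -> R) :
  (forall i, y ord0 i = c * (1 + w i)) ->
  amean y = c * (1 + mean w).
Proof.
move=> yE; rewrite [LHS](@eq_mean _ _ _ (fun i => c + c * w i + 0 * w i)).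
  by rewrite mean_lin; ring.
by move=> i; rewrite yE; ring.
Qed.

Lemma amean_sqrB_affine (R : realType) (n : nat) (y : 'rV[R]_n.+1) (c : R)
    (w : 'I_n.+1 -> R) (d : R) :
  (forall i, y ord0 i = c * (1 + w i)) ->
  amean (map_mx (fun t => (t - d) ^+ 2) y) =
  (c - d) ^+ 2 + 2 * (c - d) * c * mean w + c ^+ 2 * mean (fun i => w i ^+ 2).
Proof.
move=> yE; rewrite amean_map (@eq_mean _ _ _ (fun i =>
  (c - d) ^+ 2 + (2 * (c - d) * c) * w i + c ^+ 2 * w i ^+ 2)).
  by rewrite mean_lin.
by move=> i; rewrite yE; ring.
Qed.

Lemma amean_sqr_affine (R : realType) (n : nat) (y : 'rV[R]_n.+1) (c : R)
    (w : 'I_n.+1 -> R) :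
  (forall i, y ord0 i = c * (1 + w i)) ->
  amean (map_mx (fun t => t ^+ 2) y) =
  c ^+ 2 * (1 + 2 * mean w + mean (fun i => w i ^+ 2)).
Proof.
move=> yE; rewrite amean_map (@eq_mean _ _ _ (fun i =>
  c ^+ 2 + (2 * c ^+ 2) * w i + c ^+ 2 * w i ^+ 2)).
  by rewrite mean_lin; ring.
by move=> i; rewrite yE; ring.
Qed.

Lemma variance_affine (R : realType) (n : nat) (y : 'rV[R]_n.+1) (c : R)
    (w : 'I_n.+1 -> R) :
  (forall i, y ord0 i = c * (1 + w i)) ->
  amean (map_mx (fun t => (t - amean y) ^+ 2) y) =
  c ^+ 2 * (mean (fun i => w i ^+ 2) - mean w ^+ 2).
Proof.
by move=> yE; rewrite (amean_sqrB_affine _ yE) (amean_affine yE); ring.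
Qed.

Lemma gmean_sqr_affine (R : realType) (n : nat) (y : 'rV[R]_n.+1) (c : R)
    (w : 'I_n.+1 -> R) :
  (forall i, y ord0 i = c * (1 + w i)) ->
  0 < c -> (forall i, -1 < w i) ->
  gmean (map_mx (fun t => t ^+ 2) y) =
  c ^+ 2 * expR (2 * mean (fun i => ln (1 + w i))).
Proof.
move=> yE c0 w1; have y0 i : 0 < 1 + w i by have := w1 i; lra.
rewrite gmean_sqr; last by move=> i; rewrite yE mulr_gt0.
rewrite (@eq_mean _ _ _ (fun i => ln c + 1 * ln (1 + w i) + 0 * ln (1 + w i))).
  rewrite mean_lin mul0r addr0 mul1r mulrDr expRD; congr (_ * _).
  by rewrite expRM_natl lnK.
by move=> i; rewrite yE lnM ?posrE//; ring.
Qed.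

(** * The two inequalities for the gap between the means *)

(** Division by the square of the minimum c reduces this to [expR_mean_ln_ge]. If c = 0, the
    geometric mean vanishes and the gap is the second entry of the max. *)
Lemma AG_le (R : realType) (n : nat) (y : 'rV[R]_n.+1) :
  (forall i, 0 <= y ord0 i) ->
  amean (map_mx (fun t => t ^+ 2) y) - gmean (map_mx (fun t => t ^+ 2) y) <=
  Num.max (2 * amean (map_mx (fun t => (t - amean y) ^+ 2) y))
          (amean (map_mx (fun t => (t - vmin y) ^+ 2) y)).
Proof.
move=> y0; have [j yj] := vmin_mem y; set c := vmin y in yj *.
have : 0 <= c by rewrite yj.
rewrite le_eqVlt => /predU1P[c0|c0].
  rewrite (gmean_sqr0 (i := j)) ?subr0; last by rewrite -yj.
  rewrite le_max; apply/orP; right.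
  by rewrite !amean_map -c0; apply: le_mean => i; rewrite subr0.
pose w i := y ord0 i / c - 1.
have yE i : y ord0 i = c * (1 + w i) by rewrite /w subrKC mulrC divfK// gt_eqF.
have w0 i : 0 <= w i by rewrite subr_ge0 ler_pdivlMr// mul1r vmin_le.
rewrite (variance_affine yE) (amean_sqrB_affine _ yE) (amean_sqr_affine yE).
rewrite (gmean_sqr_affine yE)//; last by move=> i; have := w0 i; lra.
have L := expR_mean_ln_ge w0.
rewrite subrr expr0n /= !(mulr0, mul0r, add0r).
rewrite [X in Num.max X]mulrCA -maxr_pMr ?sqr_ge0//.
by rewrite -mulrBr ler_pM2l ?exprn_gt0//; lra.
Qed.

(** The maximum c is positive because v > 0, and division by c^2 reduces to [expR_mean_ln_le] when
    no coordinate is 0. The strict inequality holds since f - v = c^2 m^2; it makes the quotient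
    meaningful. *)
Lemma AG_ge (R : realType) (n : nat) (y : 'rV[R]_n.+1) :
  (forall i, 0 <= y ord0 i) ->
  let v := amean (map_mx (fun t => (t - amean y) ^+ 2) y) in
  let f := amean (map_mx (fun t => (vmax y - t) ^+ 2) y) in
  0 < v ->
  v < f /\ Num.min (2 * v) (f * v / (f - v)) <=
  amean (map_mx (fun t => t ^+ 2) y) - gmean (map_mx (fun t => t ^+ 2) y).
Proof.
move=> y0 v f v0; have [j yj] := vmax_mem y; set c := vmax y in yj f *.
have c0 : 0 < c.
  rewrite lt_neqAle yj y0 andbT; apply/eqP => yj0.
  move: v0; rewrite /v.
  have y00 i : y ord0 i = 0 * (1 + 0).
    by apply/eqP; rewrite mul0r eq_le y0 andbT yj0 -yj le_vmax.
  by rewrite (variance_affine y00) expr0n mul0r ltxx.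
pose w i := y ord0 i / c - 1.
have yE i : y ord0 i = c * (1 + w i) by rewrite /w subrKC mulrC divfK// gt_eqF.
have w0 i : w i <= 0 by rewrite subr_le0 ler_pdivrMr// mul1r le_vmax.
have w1 i : -1 <= w i by have := divr_ge0 (y0 i) (ltW c0); rewrite /w; lra.
set m := mean w; set s := mean (fun i => w i ^+ 2).
have vE : v = c ^+ 2 * (s - m ^+ 2) by rewrite /v (variance_affine yE).
have fE : f = c ^+ 2 * s.
  rewrite /f -[RHS]add0r.
  have -> : map_mx (fun t => (c - t) ^+ 2) y = map_mx (fun t => (t - c) ^+ 2) y.
    by apply/rowP => i; rewrite !mxE; ring.
  by rewrite (amean_sqrB_affine _ yE) subrr expr0n /= !(mulr0, mul0r, add0r).
have c20 : 0 < c ^+ 2 by rewrite exprn_gt0.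
have sm : 0 < s - m ^+ 2 by rewrite -(pmulr_rgt0 _ c20) -vE.
have s_le : s <= - m.
  have -> : - m = mean (fun i => 0 + (- 1) * w i + 0 * w i) by rewrite mean_lin -/m; ring.
  apply: le_mean => i; have := w0 i; have := w1 i => wi1 wi0.
  by have : 0 <= - w i * (1 + w i) by [rewrite mulr_ge0//; lra]; lra.
have m0 : m < 0 by have := sqr_ge0 m; lra.
have m20 : 0 < m ^+ 2 by rewrite exprn_even_gt0//= lt_eqF.
split; first by rewrite vE fE ltr_pM2l//; lra.
have -> : f * v / (f - v) = c ^+ 2 * (s * (s - m ^+ 2) / m ^+ 2).
  rewrite vE fE; have -> : c ^+ 2 * s - c ^+ 2 * (s - m ^+ 2) = c ^+ 2 * m ^+ 2 by ring.
  by field; rewrite (gt_eqF c0) (lt_eqF m0).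
rewrite vE (amean_sqr_affine yE) [X in Num.min X]mulrCA -minr_pMr ?sqr_ge0//.
(* With a zero coordinate the gap over c^2 is 1 + 2 m + s, to be bounded below directly. The split
   on 2 m^2 <= s is the split on r <= 1, as r = 2 m^2 / s. *)
have [/existsP[i /eqP yi]|/existsPn yn0] := boolP [exists i, y ord0 i == 0].
  rewrite (gmean_sqr0 yi) subr0 ler_pM2l// -/m -/s ge_min.
  have [ms|ms] := lerP (2 * m ^+ 2) s.
    apply/orP; left.
    have m2 : - (1 / 2) <= m.
      rewrite leNgt; apply/negP => m2.
      by have : 0 < - m * (- (2 * m) - 1) by [rewrite mulr_gt0//; lra]; lra.
    by have : 0 <= (1 + m) * (1 + 2 * m) by [rewrite mulr_ge0//; lra]; lra.
  apply/orP; right; pose b := s / m.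
  have sE : s = b * m by rewrite /b divfK ?lt_eqF.
  have b1 : -1 <= b by rewrite /b ler_ndivlMr//; lra.
  have bm : b <= m by rewrite /b ler_ndivrMr// -expr2; lra.
  (* The product expands to 1 + 2 m + s - b (b - m). *)
  have : 0 <= (1 + b) * (1 + (2 * m - b)).
    rewrite mulr_ge0//; try lra.
  have -> : s * (s - m ^+ 2) / m ^+ 2 = b * (b - m).
    by rewrite sE; field; rewrite (lt_eqF m0).
  by rewrite sE; lra.
have w1' i : -1 < w i.
  rewrite lt_neqAle w1 andbT; apply/eqP => wi; have := yn0 i.
  by rewrite yE -wi subrr mulr0 eqxx.
rewrite (gmean_sqr_affine yE)//.
rewrite -mulrBr ler_pM2l//.
have wb i : -1 < w i <= 0 by rewrite w1' w0.
by have := expR_mean_ln_le wb m0; lra.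
Qed.

(** * The gap for vectors translated far away *)

(** The upper bound comes from exp x >= 1 + x and (1 + x) (1 - x + x^2) = 1 + x^3 >= 1. *)
Lemma expRN_bounds (R : realType) (x : R) : 0 <= x ->
  1 - x <= expR (- x) <= 1 - x + x ^+ 2.
Proof.
move=> x0; rewrite expR_ge1Dx /= expRN invf_ple ?posrE ?expR_gt0//; last first.
  have := sqr_ge0 (x - 1 / 2); lra.
apply: le_trans (expR_ge1Dx x).
have p : 0 < 1 - x + x ^+ 2 by have := sqr_ge0 (x - 1 / 2); lra.
rewrite -[leLHS]mul1r ler_pdivrMr//.
have : 0 <= x ^+ 3 by rewrite exprn_ge0.
lra.
Qed.

(** The arithmetic mean of (c + w)^2 is c^2 + s, and the geometric mean is c^2 exp (- s / c^2 +
    O(c^-3)) = c^2 - s + O(1 / c); so the gap tends to 2 s. *)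
Lemma AG_shift_approx (R : realType) (n : nat) (w : 'I_n.+1 -> R) (eps : R) :
  0 < eps -> mean w = 0 -> 0 < mean (fun i => w i ^+ 2) ->
  exists2 c, (forall i, 0 < c + w i) &
  let x := map_mx (fun t => t ^+ 2) (\row_i (c + w i)) in
  `|amean x - gmean x - 2 * mean (fun i => w i ^+ 2)| <= eps.
Proof.
move=> e0 w0; set s := mean _ => s0.
pose K := mean (fun i => `|w i| ^+ 3).
pose S := \sum_i `|w i|.
pose D := 2 * K + 4 * s ^+ 2.
(* The summands ensure, in order: c >= 1, so c^-2 <= c^-1; |w i| / c <= 1/2; 2 K / c <= s; and D / c
   <= eps. In D, the term 2 K pays for the cubic remainder of ln, and 4 s^2 for the quadratic term
   of exp. *)
pose c := 1 + 2 * S + 2 * K / s + D / eps.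
have K0 : 0 <= K by apply: mean_ge0 => i; rewrite exprn_ge0.
have S0 : 0 <= S by apply: sumr_ge0.
have D0 : 0 <= D by rewrite /D; have := sqr_ge0 s; lra.
have Ks0 : 0 <= 2 * K / s by rewrite divr_ge0 ?(ltW s0)// mulr_ge0.
have De0 : 0 <= D / eps by rewrite divr_ge0 ?(ltW e0).
have c1 : 1 <= c by rewrite /c; lra.
have c0 : 0 < c by lra.
have cN0 : c != 0 by rewrite gt_eqF.
have wS i : 2 * `|w i| <= c.
  have : `|w i| <= S by rewrite /S (bigD1 i)//= lerDl sumr_ge0.
  by rewrite /c; lra.
pose u i := w i / c.
have u12 i : `|u i| <= 1 / 2.
  rewrite /u normrM normfV (gtr0_norm c0) ler_pdivrMr//.
  by have := wS i; lra.
have u1 i : -1 < u i by have := u12 i; rewrite ler_norml => /andP[]; lra.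
pose y := \row_i (c + w i).
have yE i : y ord0 i = c * (1 + u i) by rewrite mxE /u; field.
exists c.
  by move=> i; have := yE i; rewrite mxE => ->; rewrite mulr_gt0//; have := u1 i; lra.
have mu : mean u = 0.
  rewrite (@eq_mean _ _ _ (fun i => 0 + c^-1 * w i + 0 * w i)).
    by rewrite mean_lin w0; ring.
  by move=> i; rewrite /u; ring.
have mu2 : mean (fun i => u i ^+ 2) = s / c ^+ 2.
  rewrite (@eq_mean _ _ _ (fun i => 0 + c^-2 * w i ^+ 2 + 0 * w i)).
    by rewrite mean_lin -/s; ring.
  by move=> i; rewrite /u; field.
(* Error of the second-order expansion of the mean logarithm; the linear term is absent because u
   has mean 0. *)
pose th := mean (fun i => ln (1 + u i)) + s / c ^+ 2 / 2.
have thE : th = mean (fun i => ln (1 + u i) - u i + u i ^+ 2 / 2).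
  rewrite (@eq_mean _ _ _ (fun i =>
    0 + 1 * (0 + 1 * ln (1 + u i) + (-1) * u i) + 2^-1 * u i ^+ 2)).
    rewrite (mean_lin _ _ _ (fun i => 0 + 1 * ln (1 + u i) + (-1) * u i)).
    by rewrite mean_lin mu mu2 /th; ring.
  by move=> i; ring.
have thK : `|th| <= K / c ^+ 3.
  have -> : K / c ^+ 3 = mean (fun i => `|u i| ^+ 3).
    rewrite (@eq_mean _ _ _ (fun i => 0 + c^-3 * `|w i| ^+ 3 + 0 * w i)).
      by rewrite mean_lin -/K; ring.
    by move=> i; rewrite /u normrM normfV (gtr0_norm c0); field.
  rewrite thE ler_norml; apply/andP; split; last first.
    by apply: le_mean => i; have := ln1D_taylor2 (u12 i); rewrite ler_norml => /andP[].
  have -> : - mean (fun i => `|u i| ^+ 3) =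
      mean (fun i => 0 + (-1) * `|u i| ^+ 3 + 0 * u i).
    by rewrite mean_lin; ring.
  apply: le_mean => i; have := ln1D_taylor2 (u12 i); rewrite ler_norml => /andP[+ _]; lra.
pose sg := s / c ^+ 2 - 2 * th.
have sgE : 2 * mean (fun i => ln (1 + u i)) = - sg by rewrite /sg /th; field.
rewrite /= -/y (amean_sqr_affine yE) (gmean_sqr_affine yE)// mu mu2 sgE.
have c2sg : `|c ^+ 2 * sg - s| <= 2 * K / c.
  have -> : c ^+ 2 * sg - s = - (2 * c ^+ 2) * th by rewrite /sg; field.
  rewrite normrM normrN (ger0_norm (_ : 0 <= 2 * c ^+ 2));
    last by rewrite mulr_ge0 ?sqr_ge0.
  have -> : 2 * K / c = 2 * c ^+ 2 * (K / c ^+ 3) by field.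
  by rewrite ler_wpM2l// mulr_ge0 ?sqr_ge0.
have Kc : 2 * K / c <= s.
  rewrite ler_pdivrMr// -ler_pdivrMl// mulrC /c; lra.
have Dc : D / c <= eps by rewrite ler_pdivrMr// -ler_pdivrMl// mulrC /c; lra.
have c20 : 0 < c ^+ 2 by rewrite exprn_gt0.
have [sg1 sg2] : s - 2 * K / c <= c ^+ 2 * sg /\ c ^+ 2 * sg <= s + 2 * K / c.
  by move: c2sg; rewrite ler_norml => /andP[]; lra.
have sg0 : 0 <= sg by rewrite -(pmulr_rge0 _ c20); lra.
have /andP[e1 e2] := expRN_bounds sg0.
have {}e1 := ler_wpM2l (ltW c20) e1.
have {}e2 := ler_wpM2l (ltW c20) e2.
have q : c ^+ 2 * sg ^+ 2 <= 4 * s ^+ 2 / c.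
  have -> : c ^+ 2 * sg ^+ 2 = (c ^+ 2 * sg) ^+ 2 / c ^+ 2 by field.
  have h : (c ^+ 2 * sg) ^+ 2 <= 4 * s ^+ 2.
    have -> : 4 * s ^+ 2 = (2 * s) ^+ 2 by ring.
    have x0 : 0 <= c ^+ 2 * sg by rewrite mulr_ge0// ltW.
    by rewrite ler_sqr ?nnegrE; lra.
  apply: ler_pM => //; rewrite ?sqr_ge0 ?invr_ge0 ?(ltW c20)//.
  by rewrite lef_pV2 ?posrE// expr2 ler_peMr// ltW.
have DE : D / c = 2 * K / c + 4 * s ^+ 2 / c by rewrite /D; ring.
have -> : c ^+ 2 * (1 + 2 * 0 + s / c ^+ 2) = c ^+ 2 + s by field.
rewrite ler_norml; apply/andP; split; lra.
Qed.

(** * Two-valued vectors *)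

Lemma sum_if_ltn (R : realType) (n k : nat) (a d : R) : (k <= n)%N ->
  \sum_(i < n) (if (i < k)%N then a else d) = k%:R * a + (n - k)%:R * d.
Proof.
move=> kn; rewrite -(big_mkord xpredT (fun i => if (i < k)%N then a else d)).
rewrite (big_cat_nat _ kn)//=; congr (_ + _).
  rewrite big_nat (eq_bigr (fun=> a)); last by move=> i /andP[_ ->].
  by rewrite -big_nat sumr_const_nat subn0 mulr_natl.
rewrite big_nat (eq_bigr (fun=> d)); last by move=> i /andP[ki _]; rewrite ltnNge ki.
by rewrite -big_nat sumr_const_nat mulr_natl.
Qed.

Lemma mean_two_values (R : realType) (n k : nat) (a d : R) : (k <= n)%N ->
  mean (fun i : 'I_n.+1 => if (i < k)%N then a else d) =
  k%:R / n.+1%:R * a + (1 - k%:R / n.+1%:R) * d.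
Proof.
move=> kn; rewrite /mean sum_if_ltn ?leqW// natrB ?leqW//.
have : n.+1%:R != 0 :> R by rewrite pnatr_eq0.
by move: n.+1%:R => N N0; field.
Qed.

Lemma amean_two_values (R : realType) (n k : nat) (a d : R) (f : R -> R) : (k <= n)%N ->
  amean (map_mx f (\row_(i < n.+1) (if (i < k)%N then a else d))) =
  k%:R / n.+1%:R * f a + (1 - k%:R / n.+1%:R) * f d.
Proof.
move=> kn; rewrite amean_map -mean_two_values//; apply: eq_mean => i.
by rewrite mxE; case: ifP.
Qed.

Lemma variance_two_values (R : realType) (n k : nat) (a d : R) : (k <= n)%N ->
  let y : 'rV[R]_n.+1 := \row_i (if (i < k)%N then a else d) in
  let p := k%:R / n.+1%:R in
  amean (map_mx (fun t => (t - amean y) ^+ 2) y) = p * (1 - p) * (d - a) ^+ 2.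
Proof.
move=> kn y p; have -> : amean y = p * a + (1 - p) * d.
  by rewrite /amean -mean_two_values//; apply: eq_mean => i; rewrite mxE.
by rewrite amean_two_values// -/p; ring.
Qed.

Lemma vmin_two_values (R : realType) (n k : nat) (a d : R) : (0 < k)%N -> a <= d ->
  vmin (\row_(i < n.+1) (if (i < k)%N then a else d)) = a.
Proof.
move=> k0 ad; set y := \row_i _; apply: le_anti; apply/andP; split; last first.
  by have [i ->] := vmin_mem y; rewrite mxE; case: ifP.
by have := vmin_le y ord0; rewrite mxE k0.
Qed.

Lemma vmax_two_values (R : realType) (n k : nat) (a d : R) : (k <= n)%N -> a <= d ->
  vmax (\row_(i < n.+1) (if (i < k)%N then a else d)) = d.
Proof.
move=> kn ad; set y := \row_i _; apply: le_anti; apply/andP; split.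
  by have [i ->] := vmax_mem y; rewrite mxE; case: ifP.
(* As k <= n and the length is n + 1, the last coordinate is d. *)
by have := le_vmax y ord_max; rewrite mxE /= ltnNge kn.
Qed.

Lemma sqrB_vmin_two_values (R : realType) (n k : nat) (a d : R) :
  (0 < k)%N -> (k <= n)%N -> a <= d ->
  let y : 'rV[R]_n.+1 := \row_i (if (i < k)%N then a else d) in
  amean (map_mx (fun t => (t - vmin y) ^+ 2) y) =
  (1 - k%:R / n.+1%:R) * (d - a) ^+ 2.
Proof.
by move=> k0 kn ad y; rewrite vmin_two_values// amean_two_values//; ring.
Qed.

Lemma sqrB_vmax_two_values (R : realType) (n k : nat) (a d : R) : (k <= n)%N -> a <= d ->
  let y : 'rV[R]_n.+1 := \row_i (if (i < k)%N then a else d) in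
  amean (map_mx (fun t => (vmax y - t) ^+ 2) y) =
  k%:R / n.+1%:R * (d - a) ^+ 2.
Proof.
by move=> kn ad y; rewrite vmax_two_values// amean_two_values//; ring.
Qed.

(** A proportion p of lower values, translated far away, brings the gap near 2V at variance V. The
    moment about the minimum is close to V for p near 1, the one about the maximum for p near 0. *)
Lemma AG_two_values_approx (R : realType) (n k : nat) (V eps : R) :
  (0 < k)%N -> (k <= n)%N -> 0 < V -> 0 < eps ->
  let p := k%:R / n.+1%:R in
  exists y : 'rV[R]_n.+1, [/\ forall i, 0 <= y ord0 i,
    amean (map_mx (fun t => (t - amean y) ^+ 2) y) = V,
    amean (map_mx (fun t => (t - vmin y) ^+ 2) y) = V / p,
    amean (map_mx (fun t => (vmax y - t) ^+ 2) y) = V / (1 - p) &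
    `|amean (map_mx (fun t => t ^+ 2) y) - gmean (map_mx (fun t => t ^+ 2) y)
      - 2 * V| <= eps].
Proof.
move=> k0 kn V0 e0 p.
have N0 : 0 < n.+1%:R :> R by rewrite ltr0n.
have p0 : 0 < p by rewrite divr_gt0// ltr0n.
have p1 : p < 1 by rewrite ltr_pdivrMr// mul1r ltr_nat.
have q0 : 0 < p * (1 - p) by rewrite mulr_gt0// subr_gt0.
(* The distance of the two values, solving p (1 - p) d^2 = V. *)
pose d := Num.sqrt (V / (p * (1 - p))).
have d2 : d ^+ 2 = V / (p * (1 - p)) by rewrite sqr_sqrtr// divr_ge0// ltW.
have d0 : 0 <= d by exact: sqrtr_ge0.
pose w (i : 'I_n.+1) := if (i < k)%N then - (1 - p) * d else p * d.
have mw : mean w = 0 by rewrite mean_two_values// -/p; ring.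
have pN0 : p != 0 by rewrite gt_eqF.
have qN0 : 1 - p != 0 by rewrite gt_eqF// subr_gt0.
have mw2 : mean (fun i => w i ^+ 2) = V.
  rewrite (@eq_mean _ _ _ (fun i : 'I_n.+1 =>
    if (i < k)%N then (1 - p) ^+ 2 * d ^+ 2 else p ^+ 2 * d ^+ 2)).
    by rewrite mean_two_values// -/p d2; field; rewrite ?pN0 ?qN0.
  by move=> i; rewrite /w; case: ifP => _; ring.
have [|c cw Hc] := @AG_shift_approx R n w eps e0 mw; first by rewrite mw2.
rewrite mw2 in Hc.
have yE : \row_i (c + w i) =
    \row_(i < n.+1) (if (i < k)%N then c - (1 - p) * d else c + p * d).
  by apply/rowP => i; rewrite !mxE /w; case: ifP => _ //; ring.
have ad : c - (1 - p) * d <= c + p * d by lra.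
have dE : c + p * d - (c - (1 - p) * d) = d by ring.
exists (\row_i (c + w i)); split=> //.
- by move=> i; rewrite mxE ltW.
- by rewrite yE variance_two_values// -/p dE d2; field; rewrite ?pN0 ?qN0.
- by rewrite yE sqrB_vmin_two_values// -/p dE d2; field; rewrite ?pN0 ?qN0.
- by rewrite yE sqrB_vmax_two_values// -/p dE d2; field; rewrite ?pN0 ?qN0.
Qed.

(** A zero coordinate kills the geometric mean, so the gap is the mean of squares, which is also the
    moment about the minimum. *)
Lemma AG_zero_two_values (R : realType) (n k : nat) (b : R) :
  (0 < k)%N -> (k <= n)%N -> 0 <= b ->
  let p := k%:R / n.+1%:R in
  exists y : 'rV[R]_n.+1, [/\ forall i, 0 <= y ord0 i,
    amean (map_mx (fun t => (t - amean y) ^+ 2) y) = p * (1 - p) * b ^+ 2,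
    amean (map_mx (fun t => (t - vmin y) ^+ 2) y) = (1 - p) * b ^+ 2,
    amean (map_mx (fun t => (vmax y - t) ^+ 2) y) = p * b ^+ 2 &
    amean (map_mx (fun t => t ^+ 2) y) - gmean (map_mx (fun t => t ^+ 2) y)
      = (1 - p) * b ^+ 2].
Proof.
move=> k0 kn b0 p.
exists (\row_(i < n.+1) (if (i < k)%N then 0 else b)); split.
- by move=> i; rewrite mxE; case: ifP.
- by rewrite variance_two_values// subr0.
- by rewrite sqrB_vmin_two_values// subr0.
- by rewrite sqrB_vmax_two_values// subr0.
- rewrite amean_two_values// (gmean_sqr0 (i := ord0)) ?mxE ?k0//.
  by rewrite -/p; ring.
Qed.

(** * Approximation by fractions k / (n + 1) *)

Lemma exists_invn_le (R : realType) (e : R) : 0 < e ->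
  exists2 n, (0 < n)%N & n.+1%:R^-1 <= e.
Proof.
move=> e0; exists (Num.truncn e^-1).+1 => //.
rewrite invf_ple ?posrE ?ltr0n//.
by apply: le_trans (ltW (truncnS_gt _)) _; rewrite ler_nat.
Qed.

(** Take 1 / (n + 1) <= min (x, e) and k the integer part of x (n + 1): the bound by x gives k >= 1,
    x < 1 gives k <= n, and rounding costs at most e. *)
Lemma exists_ratio_approx (R : realType) (x e : R) : 0 < x < 1 -> 0 < e ->
  exists n k, [/\ (0 < k)%N, (k <= n)%N & x - e <= k%:R / n.+1%:R <= x].
Proof.
move=> /andP[x0 x1] e0.
have m0 : 0 < Num.min x e by rewrite lt_min x0.
have [n n0] := exists_invn_le m0.
rewrite le_min => /andP[nx ne].
have N0 : 0 < n.+1%:R :> R by rewrite ltr0n.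
have xN0 : 0 <= x * n.+1%:R by rewrite mulr_ge0 ?ltW.
have /andP[k1 k2] := truncn_itv xN0.
move: (Num.truncn _) k1 k2 => k k1 k2; exists n, k.
split.
- rewrite lt0n; apply/eqP => k0; move: k2; rewrite k0.
  by rewrite -ltr_pdivlMr// mul1r ltNge nx.
- rewrite -ltnS -(ltr_nat R); apply: le_lt_trans k1 _.
  by rewrite gtr_pMl.
- move: k2; rewrite -(natr1 k) => k2.
  rewrite ler_pdivrMr// k1 andbT ler_pdivlMr// mulrBl.
  have : 1 <= e * n.+1%:R by rewrite -ler_pdivrMr// mul1r.
  lra.
Qed.

(** * The extremal values over vectors of all lengths *)

Theorem corollary1 (R : realType) (V E F : R)
    (V_gt0 : 0 < V) (V_lt : V < Num.min E F) :
  ereal_sup [set r : \bar R | exists (n : nat) (y x : 'rV[R]_n.+1),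
      [/\ forall i, 0 <= y ord0 i,
          x = map_mx (fun t => t ^+ 2) y,
          amean (map_mx (fun t => (t - amean y) ^+ 2) y) <= V,
          amean (map_mx (fun t => (t - vmin y) ^+ 2) y) <= E
        & r = (amean x - gmean x)%:E]]
    = (Num.max (2 * V) E)%:E
  /\
  ereal_inf [set r : \bar R | exists (n : nat) (y x : 'rV[R]_n.+1),
      [/\ forall i, 0 <= y ord0 i,
          x = map_mx (fun t => t ^+ 2) y,
          V <= amean (map_mx (fun t => (t - amean y) ^+ 2) y),
          amean (map_mx (fun t => (vmax y - t) ^+ 2) y) <= F
        & r = (amean x - gmean x)%:E]]
    = (Num.min (2 * V) (F * V / (F - V)))%:E.
Proof.
move: V_lt; rewrite lt_min => /andP[VE VF].
have E0 : 0 < E by lra.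
have F0 : 0 < F by lra.
have FV0 : 0 < F - V by lra.
split; apply/eqP; rewrite eq_le; apply/andP; split.
- apply: ge_ereal_sup => _ [n [y [x [y0 -> yV yE ->]]]].
  rewrite lee_fin; apply: le_trans (AG_le y0) _.
  by rewrite ge_max !le_max ler_pM2l// yV yE orbT.
- rewrite EFin_max ge_max; apply/andP; split.
    apply/lee_addgt0Pr => eps eps0.
    (* With p = n / (n + 1) = 1 - 1 / (n + 1) >= V / E, the moment V / p is at most E. *)
    have e0 : 0 < 1 - V / E by rewrite subr_gt0 ltr_pdivrMr// mul1r.
    have [n n0 ne] := exists_invn_le e0.
    have [y [y0 yV yE _ yAG]] :=
      @AG_two_values_approx R n n V eps n0 (leqnn n) V_gt0 eps0.
    have pE : n%:R / n.+1%:R = 1 - n.+1%:R^-1 :> R.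
      have : n.+1%:R != 0 :> R by rewrite pnatr_eq0.
      have -> : n%:R = n.+1%:R - 1 :> R by rewrite -natr1 addrK.
      by move: n.+1%:R => N N0; field.
    apply: (@le_trans _ _ ((amean (map_mx (fun t => t ^+ 2) y) -
      gmean (map_mx (fun t => t ^+ 2) y))%:E + eps%:E)%E).
      by rewrite -EFinD lee_fin; move: yAG; rewrite ler_norml => /andP[]; lra.
    rewrite leeD2r//; apply: ereal_sup_ubound;
      exists n, y, (map_mx (fun t => t ^+ 2) y); split=> //.
      by rewrite yV.
    rewrite yE pE; move: (n.+1%:R^-1) ne => q ne.
    rewrite ler_pdivrMr; last by have := divr_gt0 V_gt0 E0; lra.
    by rewrite -ler_pdivrMl// mulrC; lra.
  (* E is attained: one zero coordinate, p = 1 / (n + 1) <= V / E and b^2 = E / (1 - p) give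
     variance p E <= V and gap E. *)
  have [n n0 ne] := exists_invn_le (divr_gt0 V_gt0 E0).
  have q0 : 0 < 1 - 1%:R / n.+1%:R :> R.
    by rewrite subr_gt0 mul1r invf_lt1 ?ltr0n// ltr1n.
  have [y [y0 yV yE _ yAG]] := @AG_zero_two_values R n 1
    (Num.sqrt (E / (1 - 1%:R / n.+1%:R))) isT n0 (sqrtr_ge0 _).
  rewrite sqr_sqrtr in yV yE yAG; last by rewrite divr_ge0// ltW.
  apply: ereal_sup_ubound;
      exists n, y, (map_mx (fun t => t ^+ 2) y); split=> //.
  + rewrite yV; move: q0; rewrite mul1r; move: (n.+1%:R^-1) ne => q ne q0.
    have -> : q * (1 - q) * (E / (1 - q)) = q * E by field; rewrite gt_eqF.
    by rewrite -ler_pdivlMr.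
  + by rewrite yE mulrC divfK ?gt_eqF.
  + by rewrite yAG mulrC divfK ?gt_eqF.
- rewrite EFin_min le_min; apply/andP; split; apply/lee_addgt0Pr => eps eps0.
    (* Here p = 1 / (n + 1) <= 1 - V / F, so V / (1 - p) <= F. *)
    have e0 : 0 < 1 - V / F by rewrite subr_gt0 ltr_pdivrMr// mul1r.
    have [n n0 ne] := exists_invn_le e0.
    have [y [y0 yV _ yF yAG]] :=
      @AG_two_values_approx R n 1 V eps isT n0 V_gt0 eps0.
    apply: (@le_trans _ _ (amean (map_mx (fun t => t ^+ 2) y) -
      gmean (map_mx (fun t => t ^+ 2) y))%:E); last first.
      by rewrite -EFinD lee_fin; move: yAG; rewrite ler_norml => /andP[]; lra.
    apply: ereal_inf_lbound;
      exists n, y, (map_mx (fun t => t ^+ 2) y); split=> //.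
      by rewrite yV.
    rewrite yF mul1r; move: (n.+1%:R^-1) ne => q ne.
    rewrite ler_pdivrMr; last by have := divr_gt0 V_gt0 F0; lra.
    by rewrite -ler_pdivrMl// mulrC; lra.
  (* A proportion x of zeros with b^2 = F / x would give variance V and gap F V / (F - V) exactly.
     As x may be irrational, p approximates it from below, which keeps the variance (1 - p) F at
     least V. *)
  pose x := 1 - V / F.
  have x0 : 0 < x by rewrite subr_gt0 ltr_pdivrMr// mul1r.
  have x1 : x < 1 by have := divr_gt0 V_gt0 F0; rewrite /x; lra.
  have x01 : 0 < x < 1 by rewrite x0.
  (* The first entry gives p >= x / 2; then F / p - F / x = F (x - p) / (x p) is at most 2 F e / x^2
     <= eps. *)
  pose e := Num.min (x / 2) (x ^+ 2 / (2 * F) * eps).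
  have e0 : 0 < e.
    by rewrite lt_min divr_gt0//= mulr_gt0// divr_gt0 ?exprn_gt0// mulr_gt0.
  have [n [k [k0 kn /andP[px1 px2]]]] := exists_ratio_approx x01 e0.
  have [e1 e2] : e <= x / 2 /\ e <= x ^+ 2 / (2 * F) * eps.
    by split; rewrite ge_min lexx ?orbT.
  have [y [y0 yV _ yF yAG]] := @AG_zero_two_values R n k
    (Num.sqrt (F / (k%:R / n.+1%:R))) k0 kn (sqrtr_ge0 _).
  move: (k%:R / n.+1%:R) px1 px2 yV yF yAG => p px1 px2.
  have p0 : 0 < p by lra.
  rewrite sqr_sqrtr; last by rewrite divr_ge0// ltW.
  move=> yV yF yAG.
  apply: (@le_trans _ _ (amean (map_mx (fun t => t ^+ 2) y) -
      gmean (map_mx (fun t => t ^+ 2) y))%:E).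
    apply: ereal_inf_lbound;
      exists n, y, (map_mx (fun t => t ^+ 2) y); split=> //.
      rewrite yV; have -> : V = (1 - x) * F by rewrite /x; field; rewrite gt_eqF.
      have -> : p * (1 - p) * (F / p) = (1 - p) * F by field; rewrite gt_eqF.
      by rewrite ler_pM2r//; lra.
    by rewrite yF mulrC divfK ?gt_eqF.
  rewrite -EFinD lee_fin yAG.
  have -> : F * V / (F - V) = F / x - F.
    by rewrite /x; field; rewrite !gt_eqF.
  have -> : (1 - p) * (F / p) = F / p - F by field; rewrite gt_eqF.
  suff : F / p <= F / x + eps by lra.
  rewrite ler_pdivrMr//.
  have -> : (F / x + eps) * p = F - F / x * (x - p) + eps * p.
    by field; rewrite gt_eqF.
  suff : F / x * (x - p) <= eps * p by lra.
  apply: (@le_trans _ _ (F / x * (x ^+ 2 / (2 * F) * eps))).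
    by rewrite ler_pM2l ?divr_gt0//; lra.
  have -> : F / x * (x ^+ 2 / (2 * F) * eps) = eps * (x / 2).
    by field; rewrite !gt_eqF.
  by rewrite ler_pM2l//; lra.
- apply: le_ereal_inf_tmp => _ [n [y [x [y0 -> yV yF ->]]]].
  rewrite lee_fin.
  have [vf] := AG_ge y0 (lt_le_trans V_gt0 yV).
  apply: le_trans.
  set v := amean _ in yV vf *; set f := amean _ in yF vf *.
  rewrite le_min !ge_min ler_pM2l// yV /=; apply/orP; right.
  have vf0 : 0 < f - v by rewrite subr_gt0.
  rewrite ler_pdivrMr// mulrAC ler_pdivlMr//.
  clearbody v f.
  (* f v / (f - v) = 1 / (1 / v - 1 / f) grows with v and decreases in f; after clearing
     denominators the difference is the sum of [h1] and [h2]. *)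
  have h1 : 0 <= f * F * (v - V) by rewrite !mulr_ge0//; lra.
  have h2 : 0 <= v * V * (F - f) by rewrite !mulr_ge0//; lra.
  lra.
Qed.
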